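(* Let $X$ be a proper submodule of $M$. Then the following are equivalent: (1) $X$ is a $\phi$-prime submodule of $M$. (2) For all $m\in M\setminus X$, $(X:_{R}mR)=(X:_{R}M)\cup(\phi(X):_{R}mR)$. (3) For all $m\in M\setminus X$, $(X:_{R}mR)=(X:_{R}M)$ or $(X:_{R}mR)=(\phi(X):_{R}mR)$.
   Context: $R$ is an associative ring with identity, not necessarily commutative, and $M$ is a unitary right $R$-module. $S(M)$ is the set of all submodules of $M$; ''ideal'' means two-sided ideal. For a submodule $Y$ of $M$ and $I\subseteq R$, $YI$ is the set of finite sums of elements $yr$ with $y\in Y$, $r\in I$. For subsets $X,Y$ of $M$, $(Y:_{R}X)=\{r\in R: Xr\subseteq Y\}$ (also used with $Y=\emptyset$). For $m\in M$, $mR$ is the submodule generated by $m$. A function $\phi:S(M)\to S(M)\cup\{\emptyset\}$ is fixed, with the standing convention that $\phi(X)\subseteq X$ for every $X\in S(M)$. A proper submodule $X$ of $M$ is $\phi$-prime if for every $Y\in S(M)$ and every ideal $I$ of $R$, $YI\subseteq X$ and $YI\nsubseteq\phi(X)$ imply $Y\subseteq X$ or $I\subseteq(X:_{R}M)$. *)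

(* Defs.v *)
From HB Require Import structures.
From mathcomp Require Import all_boot all_algebra all_classical.

Set Implicit Arguments.
Unset Strict Implicit.
Unset Printing Implicit Defensive.

Import GRing.Theory.
Local Open Scope ring_scope.
Local Open Scope classical_set_scope.

(* A unitary right R-module is a left module over the converse ring R^c:
   in M : lmodType R^c, scaling by a product a * b of R is scaling by a,
   followed by scaling by b.  We write m *< r for m acted on by r : R on the
   right. *)
Definition ract (R : pzRingType) (M : lmodType R^c) (m : M) (r : R) : M :=
  (r : R^c) *: m.

Notation "m *< r" := (ract m r) (at level 40, left associativity) : ring_scope.

Lemma ractM (R : pzRingType) (M : lmodType R^c) (m : M) (r s : R) :
  m *< (r * s) = m *< r *< s.
Proof. by rewrite /ract scalerA. Qed.

Record submodule (R : pzRingType) (M : lmodType R^c) := Submodule {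
  submodule_set :> set M;
  submodule_closed : submod_closed [in submodule_set] }.

(* S(M) extended with the empty set, which is represented by None. *)
Definition osubmodule_set (R : pzRingType) (M : lmodType R^c)
    (Z : option (submodule M)) : set M :=
  if Z is Some Z' then Z' : set M else set0.

Definition two_sided_ideal (R : pzRingType) (I : set R) : Prop :=
  zmod_closed [in I] /\
  forall r a : R, I a -> I (r * a) /\ I (a * r).

(* The set Y I of finite sums of elements y *< r, with y in Y and r in I. *)
Definition set_ract (R : pzRingType) (M : lmodType R^c)
    (Y : set M) (I : set R) : set M :=
  [set x | exists (n : nat) (y : 'I_n -> M) (r : 'I_n -> R),
    (forall i, Y (y i) /\ I (r i)) /\ x = \sum_(i < n) y i *< r i].

(* (Y :_R X) *)
Definition colon (R : pzRingType) (M : lmodType R^c) (Y X : set M) : set R :=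
  [set r | forall x, X x -> Y (x *< r)].

(* m R *)
Definition cyclic_set (R : pzRingType) (M : lmodType R^c) (m : M) : set M :=
  [set m *< r | r in [set: R]].

Lemma cyclic_setE (R : pzRingType) (M : lmodType R^c) (m : M) :
  cyclic_set m = smallest (fun X : set M => submod_closed [in X]) [set m].
Proof.
apply/seteqP; split.
  move=> _ [r _ <-] X [[X0 XD] mX].
  have Xm : m \in X by rewrite inE; exact: mX.
  by have := XD (r : R^c) m 0 Xm X0; rewrite addr0 unfold_in inE.
apply: smallest_sub; last by move=> _ ->; exists 1; rewrite // /ract scale1r.
split=> [|a u v]; first by rewrite unfold_in inE; exists 0; rewrite // /ract scale0r.
rewrite !unfold_in !inE => -[r _ <-] [s _ <-].
by exists ((a : R^c) * (r : R^c) + (s : R^c)); rewrite // /ract scalerDl scalerA.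
Qed.

Definition phi_prime (R : pzRingType) (M : lmodType R^c)
    (phi : submodule M -> option (submodule M)) (X : submodule M) : Prop :=
  (X : set M) `<` [set: M] /\
  forall (Y : submodule M) (I : set R), two_sided_ideal I ->
    set_ract Y I `<=` X -> ~ (set_ract Y I `<=` osubmodule_set (phi X)) ->
    (Y : set M) `<=` X \/ I `<=` colon X [set: M].

(* Main.v *)
Require Import Defs.
From HB Require Import structures.
From mathcomp Require Import all_boot all_algebra all_classical.

Import GRing.Theory.
Local Open Scope ring_scope.
Local Open Scope classical_set_scope.

(** The residual [(X : mR)] is itself a two-sided ideal, and it multiplies [mR]
    into [X].  For [m] outside [X], testing primeness on the pair made of [mR]
    and [(X : mR)] therefore leaves two cases: either [(X : mR)] is contained
    in [(X : M)], or [mR (X : mR)] lies in [phi(X)], that is, [(X : mR)] is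
    contained in [(phi(X) : mR)].  As both [(X : M)] and [(phi(X) : mR)] are
    always contained in [(X : mR)], this is the dichotomy (3)
    ([phi_prime_colon_cyclic]).

    Conversely, let [YI] be contained in [X], with [Y] not contained in [X] and
    [I] not contained in [(X : M)].  For [m] in [Y] but not in [X], the ideal
    [I] is contained in [(X : mR)], so (3) forces [mI] into [phi(X)].  The
    remaining elements of [Y] are differences of elements of [Y] outside [X],
    because adding an element of [X] to one outside [X] stays outside [X];
    hence [YI] lies in [phi(X)] ([colon_cyclic_phi_prime]).

    Finally, (3) implies (2) by the same inclusions, and (2) implies (3)
    because an additive group covered by two subgroups is equal to one of them
    ([zmod_closed_subsetU]). *)

(** * Additive subgroups and residuals *)

(** If [a] in [C] avoids [A] and [b] in [C] avoids [B], then [a] is in [B] and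
    [b] is in [A], so [a - b] can be in neither. *)
Lemma zmod_closed_subsetU (V : zmodType) (A B C : set V) :
    zmod_closed [in A] -> zmod_closed [in B] -> zmod_closed [in C] ->
  C `<=` A `|` B -> C `<=` A \/ C `<=` B.
Proof.
move=> [A0 AB] [B0 BB] [_ CB] CAB.
have [CA|nCA] := pselect (C `<=` A); [by left | right => b Cb].
have [a Ca nAa] : exists2 a, C a & ~ A a.
  by move/existsNP: nCA => [a /not_implyP[Ca nAa]]; exists a.
have [Ab|//] := CAB b Cb.
have [//|Ba] := CAB a Ca.
have : C (a - b) by apply/set_mem/CB; rewrite inE.
case/CAB => [Aab|Bab].
  have Aba : A (- b).
    by rewrite -sub0r; apply/set_mem/AB => //; rewrite inE.
  case: nAa; rewrite -(subrK b a) -[X in _ + X]opprK.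
  by apply/set_mem/AB; rewrite inE.
rewrite -[b](subKr a).
by apply/set_mem/BB; rewrite inE.
Qed.

Section Residuals.
Set Implicit Arguments.
Variables (R : pzRingType) (M : lmodType R^c).
Implicit Types (X Y : submodule M) (S : set M) (m : M) (r : R).

Lemma submodule_lin X r u v :
  (X : set M) u -> (X : set M) v -> (X : set M) (u *< r + v).
Proof.
move=> Xu Xv; have [_ XD] := submodule_closed X.
by apply/set_mem/(XD (r : R^c)); rewrite inE.
Qed.

Lemma submodule0 X : (X : set M) 0.
Proof. by have [X0 _] := submodule_closed X; apply/set_mem/X0. Qed.

Lemma ract1 m : m *< 1 = m. Proof. exact: scale1r. Qed.

Lemma ractDl m n r : (m + n) *< r = m *< r + n *< r.
Proof. exact: scalerDr. Qed.

Lemma ractBr m r s : m *< (r - s) = m *< r - m *< s.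
Proof. exact: scalerBl. Qed.

Lemma ract0 m : m *< 0 = 0. Proof. exact: scale0r. Qed.

Lemma submodule_ract X r u : (X : set M) u -> (X : set M) (u *< r).
Proof.
move=> Xu; rewrite -[_ *< _]addr0.
exact: submodule_lin (submodule0 X).
Qed.

Lemma submoduleD X u v : (X : set M) u -> (X : set M) v -> (X : set M) (u + v).
Proof. by move=> Xu Xv; rewrite -[u]ract1; apply: submodule_lin. Qed.

Lemma submoduleB X u v : (X : set M) u -> (X : set M) v -> (X : set M) (u - v).
Proof.
move=> Xu Xv; rewrite addrC -[- v](scaleN1r (v : M)).
exact: (@submodule_lin X (-1)).
Qed.

Lemma cyclic_set_id m : cyclic_set m m.
Proof. by exists 1 => //; exact: ract1. Qed.

Lemma cyclic_set_closed m : submod_closed [in cyclic_set m].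
Proof.
rewrite cyclic_setE; split=> [|a u v].
  by rewrite inE => S [[S0 _] _]; exact: set_mem.
rewrite !inE => mu mv S Sm; have [[_ SD] _] := Sm.
by apply/set_mem/SD; rewrite inE; [exact: mu | exact: mv].
Qed.

Lemma zmod_closed_colon X S : zmod_closed [in colon X S].
Proof.
split=> [|r s]; rewrite !inE.
  by move=> m _; rewrite ract0; exact: submodule0.
move=> Xr Xs m Sm; rewrite ractBr.
by apply: submoduleB; [exact: Xr | exact: Xs].
Qed.

(** Closure under multiplication on the left is where stability of the second
    submodule under the action is needed. *)
Lemma two_sided_ideal_colon X Y : two_sided_ideal (colon X Y).
Proof.
split=> [|r a Xa]; first exact: zmod_closed_colon.
split=> m Ym; rewrite ractM.
  exact/Xa/submodule_ract.
exact/submodule_ract/Xa.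
Qed.

Lemma colon_subset S1 S2 T1 T2 :
  S1 `<=` S2 -> T2 `<=` T1 -> colon S1 T1 `<=` colon S2 T2.
Proof. by move=> S12 T21 r S1r m /T21 /S1r /S12. Qed.

(** Nonemptiness of [m R] makes its residual into the empty set empty. *)
Lemma colon_set0_cyclic m : colon set0 (cyclic_set m) = set0.
Proof. by apply/seteqP; split=> // r /(_ m (cyclic_set_id m)). Qed.

Lemma set_ract_subset X S (I : set R) :
  (forall m r, S m -> I r -> (X : set M) (m *< r)) -> set_ract S I `<=` X.
Proof.
move=> SIX _ [n [y [r [yr ->]]]].
apply: (big_ind (X : set M)) => [|u v|i _]; first exact: submodule0.
  exact: submoduleD.
by have [Sy Ir] := yr i; exact: SIX.
Qed.

Lemma mem_set_ract S (I : set R) m r : S m -> I r -> set_ract S I (m *< r).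
Proof.
by move=> Sm Ir; exists 1, (fun=> m), (fun=> r); split=> //; rewrite big_ord1.
Qed.

(** * Primeness in terms of residuals *)

Variable phi : submodule M -> option (submodule M).
Hypothesis phi_sub : forall X, osubmodule_set (phi X) `<=` X.

Lemma colon_cyclic_supset X m :
  colon X [set: M] `|` colon (osubmodule_set (phi X)) (cyclic_set m)
    `<=` colon X (cyclic_set m).
Proof. by move=> r [|]; exact: colon_subset. Qed.

(** Primeness is applied to [mR] and the ideal [(X : mR)]. *)
Lemma phi_prime_colon_cyclic X m : phi_prime phi X -> ~ (X : set M) m ->
  colon X (cyclic_set m) = colon X [set: M] \/
  colon X (cyclic_set m) = colon (osubmodule_set (phi X)) (cyclic_set m).
Proof.
move=> [_ primeX] nXm; have supX := @colon_cyclic_supset X m.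
pose mR := Submodule (cyclic_set_closed m).
have mRI : set_ract mR (colon X mR) `<=` X.
  by apply: set_ract_subset => x r mx; exact.
have [sub_phi|nsub_phi] :=
  pselect (set_ract mR (colon X mR) `<=` osubmodule_set (phi X)).
  right; apply/seteqP; split=> r Xr; last by apply: supX; right.
  by move=> x mx; apply/sub_phi/mem_set_ract.
have [mRX|IX] := primeX mR _ (two_sided_ideal_colon X mR) mRI nsub_phi.
  by case: nXm; apply: mRX; exact: cyclic_set_id.
by left; apply/seteqP; split=> // r Xr; apply: supX; left.
Qed.

Lemma colon_cyclic_phi_prime X : (X : set M) `<` [set: M] ->
    (forall m, ~ (X : set M) m ->
      colon X (cyclic_set m) = colon X [set: M] \/
      colon X (cyclic_set m) =
        colon (osubmodule_set (phi X)) (cyclic_set m)) ->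
  phi_prime phi X.
Proof.
move=> properX dichX; split=> // Y I idealI YIX nYIphi.
apply: contrapT => /not_orP[nYX nIX]; apply: nYIphi.
have [[I0 _] Imul] := idealI.
have YphiX m r : (Y : set M) m -> ~ (X : set M) m -> I r ->
    osubmodule_set (phi X) (m *< r).
  move=> Ym nXm Ir.
  have IXm : I `<=` colon X (cyclic_set m).
    move=> a Ia _ [s _ <-]; rewrite -ractM; apply/YIX/mem_set_ract => //.
    by have [] := Imul s a Ia.
  have [eqX|eqphi] := dichX m nXm; first by case: nIX; rewrite -eqX.
  by move/IXm: Ir; rewrite eqphi; apply; exact: cyclic_set_id.
have [m Ym nXm] : exists2 m, (Y : set M) m & ~ (X : set M) m.
  by move/existsNP: nYX => [m /not_implyP[Ym nXm]]; exists m.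
(* The value at m and 0 shows that phi(X) is not the empty set. *)
have := YphiX m 0 Ym nXm (set_mem I0).
case: (phi X) YphiX => [Z|//] YZ _; apply: set_ract_subset => x r Yx Ir.
have [Xx|nXx] := pselect ((X : set M) x); last exact: YZ.
rewrite -[_ *< _](addrK (m *< r)) -ractDl.
apply: submoduleB; last exact: YZ.
apply: YZ => //; first exact: submoduleD.
by move=> Xxm; apply: nXm; rewrite -[m](addKr x) addrC; exact: submoduleB.
Qed.

Lemma colon_cyclic_setUP X m :
  colon X (cyclic_set m) =
    colon X [set: M] `|` colon (osubmodule_set (phi X)) (cyclic_set m) <->
  (colon X (cyclic_set m) = colon X [set: M] \/
   colon X (cyclic_set m) = colon (osubmodule_set (phi X)) (cyclic_set m)).
Proof.
have supX := @colon_cyclic_supset X m.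
split=> [eqU|eqV]; last first.
  apply/seteqP; split=> // r.
  by case: eqV => ->; [left | right].
have XU : colon X (cyclic_set m) `<=`
    colon X [set: M] `|` colon (osubmodule_set (phi X)) (cyclic_set m).
  by rewrite eqU.
have [XM|Xphi] : colon X (cyclic_set m) `<=` colon X [set: M] \/
    colon X (cyclic_set m) `<=` colon (osubmodule_set (phi X)) (cyclic_set m).
- case: (phi X) XU => [Z|] /= XU.
    by apply: zmod_closed_subsetU XU; exact: zmod_closed_colon.
  by left; move: XU; rewrite colon_set0_cyclic setU0.
- by left; apply/seteqP; split=> // r Xr; apply: supX; left.
- by right; apply/seteqP; split=> // r Xr; apply: supX; right.
Qed.

End Residuals.

Theorem theorem1 (R : pzRingType) (M : lmodType R^c)
    (phi : submodule M -> option (submodule M))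
    (phi_sub : forall X : submodule M, osubmodule_set (phi X) `<=` X)
    (X : submodule M) (properX : (X : set M) `<` [set: M]) :
  let P1 := phi_prime phi X in
  let P2 := forall m : M, ~ (X : set M) m ->
    colon X (cyclic_set m) =
      colon X [set: M] `|` colon (osubmodule_set (phi X)) (cyclic_set m) in
  let P3 := forall m : M, ~ (X : set M) m ->
    colon X (cyclic_set m) = colon X [set: M] \/
    colon X (cyclic_set m) = colon (osubmodule_set (phi X)) (cyclic_set m) in
  (P1 <-> P2) /\ (P2 <-> P3).
Proof.
move=> P1 P2 P3.
have P23 : P2 <-> P3.
  have U3 := colon_cyclic_setUP _ phi_sub X.
  by split=> PX m nXm; apply/U3/PX.
split=> //; rewrite P23; split=> [primeX m|].
  exact: phi_prime_colon_cyclic.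
exact: colon_cyclic_phi_prime.
Qed.
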